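(* Let $z^*\in\mathcal Z$ be a solution of the variational inequality $\langle F(z^* ),z-z^*\rangle+g(z)-g(z^* )\ge0$ for all $z\in\mathcal Z$. Suppose that: (i) for every $\xi$ and all $u,v\in\mathcal Z$, $\|F_1(u)-F(u,\xi)-F_1(v)+F(v,\xi)\|_*\le\delta\|u-v\|$; (ii) $\mathbb E_\xi[F(z,\xi)]=F(z)$ for all $z\in\mathcal Z$ and $\mathbb E_\xi[\|F(z^*,\xi)-F(z^* )\|_*^2]\le\sigma_*^2$; (iii) $F(\cdot,\xi)$ is $\mu$-strongly monotone with respect to the distance generating function $w$, i.e. for all $u,v\in\mathcal Z$ and every $\xi$, $$\langle F(u,\xi)-F(v,\xi),u-v\rangle\ge\frac\mu2\left(V(u,v)+V(v,u)\right).$$ Let $\{z^k\}$ be generated by the algorithm PAUS (described in the context) with $\alpha=\frac{\gamma\mu}2$, $\gamma\le\frac1{2\delta}$ and a starting point $z^0\in\mathcal Z$. Then $$\mathbb E\left[V(z^*,z^{k+1})\right]\le\left(1-\frac{\gamma\mu}4\right)\mathbb E\left[V(z^*,z^k)\right]+\frac{2\gamma^2}3\sigma_*^2 .$$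
   Context: Setting: $\mathcal Z\subseteq\mathbb R^d$ is a closed convex set, $\|\cdot\|$ is a general norm and $\|s\|_*=\max\{\langle s,x\rangle:\|x\|=1\}$ its dual norm. $g:\mathcal Z\to\mathbb R$ is a proper convex lower semicontinuous function. $F=\frac1m\sum_{i=1}^mF_i:\mathcal Z\to\mathbb R^d$ is a monotone and Lipschitz operator, $F_1$ is the operator held by the server, and $F(\cdot,\xi)=\frac1m\sum_{i=1}^mF_i(\cdot,\xi_i)$ is a stochastic oracle of $F$ depending on a random variable $\xi$. A function $w:\mathcal Z\to\mathbb R$ is a distance generating function if it is 1-strongly convex with respect to $\|\cdot\|$: $w(v)\ge w(u)+\langle\nabla w(u),v-u\rangle+\frac12\|v-u\|^2$ for all $u,v\in\mathcal Z$. Such a $w$ is fixed, and $V(u,v)=w(u)-w(v)-\langle\nabla w(v),u-v\rangle$ is the corresponding Bregman divergence. Algorithm PAUS with stepsize $\gamma$, parameter $\alpha\ge0$, number of iterations $K$ and starting points $z^0=u^0\in\mathcal Z$. For $k=0,1,\dots,K-1$: (1) sample a random variable $\xi^k$ and collect $F(z^k,\xi^k)$ on the server; (2) find $u^k\in\mathcal Z$ as a solution to: for all $z\in\mathcal Z$, $$\langle\gamma(F_1(u^k)+F(z^k,\xi^k)-F_1(z^k))+\nabla w(u^k)-\nabla w(z^k),\,z-u^k\rangle+\gamma(g(z)-g(u^k))\ge0;$$ (3) collect $F(u^k,\xi^k)$ on the server and set $$z^{k+1}=\arg\min_{z\in\mathcal Z}\left\{\gamma\langle F(u^k,\xi^k)-F_1(u^k)-F(z^k,\xi^k)+F_1(z^k),z\rangle+(1+\alpha)V(z,u^k)\right\}.$$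 In the strongly monotone case the output is $z^K$.
   Formalization: The condition γμ ≤ 2 is added: without it the inequality fails (F = F_1 = F(·,ξ) = x on R, g = 0, w = x²/2, μ = 2, δ = 1/10, γ = 5, σ_* = 0 gives a negative right-hand side), and for every γμ > 2 some admissible w violates it. *)

(* Defs.v *)
From HB Require Import structures.
From mathcomp Require Import all_boot all_order all_algebra.
From mathcomp Require Import all_classical all_reals all_analysis.

Set Implicit Arguments.
Unset Strict Implicit.
Unset Printing Implicit Defensive.

Import Order.TTheory GRing.Theory Num.Theory.
Import numFieldNormedType.Exports.

Local Open Scope classical_set_scope.
Local Open Scope ring_scope.

(* Throughout, functions and operators on a set Z of R^d are total functions on
   'rV[R]_d of which only the values on Z are constrained or used. *)

Definition dotv (R : realType) (d : nat) (u v : 'rV[R]_d) : R :=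
  \sum_(j < d) u ord0 j * v ord0 j.

(* An arbitrary norm on R^d, unrelated to the canonical (sup) norm `|x| of
   'rV[R]_d, which only serves to define the topology. *)
Record is_norm (R : realType) (d : nat) (N : 'rV[R]_d -> R) : Prop := IsNorm {
  norm_triangle : forall x y, N (x + y) <= N x + N y ;
  norm_homog : forall (a : R) x, N (a *: x) = `|a| * N x ;
  norm_definite : forall x, N x = 0 -> x = 0 }.

(* The supremum is a maximum when d > 0, the unit sphere being compact. *)
Definition dual_norm (R : realType) (d : nat) (N : 'rV[R]_d -> R)
    (s : 'rV[R]_d) : R :=
  sup [set dotv s x | x in [set x | N x = 1]].

(* Differentiability relative to Z: at u, only increments v - u with v in Z are
   tested, so Z may have an empty interior. In that case gw is a choice of
   gradient; its component orthogonal to Z is irrelevant below. *)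
Definition is_gradient_on (R : realType) (d : nat) (Z : set 'rV[R]_d)
    (w : 'rV[R]_d -> R) (gw : 'rV[R]_d -> 'rV[R]_d) : Prop :=
  forall u, Z u -> forall e : R, 0 < e ->
    \forall v \near within Z (nbhs u),
      `|w v - w u - dotv (gw u) (v - u)| <= e * `|v - u|.

Definition distance_generating (R : realType) (d : nat) (N : 'rV[R]_d -> R)
    (Z : set 'rV[R]_d) (w : 'rV[R]_d -> R) (gw : 'rV[R]_d -> 'rV[R]_d) : Prop :=
  is_gradient_on Z w gw /\
  forall u v, Z u -> Z v ->
    w v >= w u + dotv (gw u) (v - u) + 2^-1 * N (v - u) ^+ 2.

Definition bregman (R : realType) (d : nat) (w : 'rV[R]_d -> R)
    (gw : 'rV[R]_d -> 'rV[R]_d) (u v : 'rV[R]_d) : R :=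
  w u - w v - dotv (gw v) (u - v).

Definition monotone_on (R : realType) (d : nat) (Z : set 'rV[R]_d)
    (A : 'rV[R]_d -> 'rV[R]_d) : Prop :=
  forall u v, Z u -> Z v -> 0 <= dotv (A u - A v) (u - v).

Definition strongly_monotone_on (R : realType) (d : nat) (Z : set 'rV[R]_d)
    (w : 'rV[R]_d -> R) (gw : 'rV[R]_d -> 'rV[R]_d) (mu : R)
    (A : 'rV[R]_d -> 'rV[R]_d) : Prop :=
  forall u v, Z u -> Z v ->
    dotv (A u - A v) (u - v) >= mu / 2 * (bregman w gw u v + bregman w gw v u).

Definition lipschitz_dual_on (R : realType) (d : nat) (N : 'rV[R]_d -> R)
    (Z : set 'rV[R]_d) (L : R) (A : 'rV[R]_d -> 'rV[R]_d) : Prop :=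
  forall u v, Z u -> Z v -> dual_norm N (A u - A v) <= L * N (u - v).

(* Semicontinuity is for the subspace topology of Z. *)
Definition lsc_on (R : realType) (d : nat) (Z : set 'rV[R]_d)
    (g : 'rV[R]_d -> R) : Prop :=
  lower_semicontinuous (fun x : subspace Z => (g x)%:E).

Definition avg_op (R : realType) (d m : nat)
    (Fi : 'I_m -> 'rV[R]_d -> 'rV[R]_d) (z : 'rV[R]_d) : 'rV[R]_d :=
  m%:R^-1 *: \sum_(i < m) Fi i z.

(* [comp i x] is the component xi_i, seen by node i, of the sample x of xi, and
   [Gi i z y] is the local oracle F_i(z, y). *)
Definition avg_oracle (R : realType) (d m : nat) (X : Type) (Xi : 'I_m -> Type)
    (comp : forall i, X -> Xi i) (Gi : forall i, 'rV[R]_d -> Xi i -> 'rV[R]_d)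
    (z : 'rV[R]_d) (x : X) : 'rV[R]_d :=
  m%:R^-1 *: \sum_(i < m) Gi i z (comp i x).

Definition vi_solution (R : realType) (d : nat) (Z : set 'rV[R]_d)
    (A : 'rV[R]_d -> 'rV[R]_d) (g : 'rV[R]_d -> R) (zs : 'rV[R]_d) : Prop :=
  Z zs /\ forall z, Z z -> 0 <= dotv (A zs) (z - zs) + g z - g zs.

Definition has_mean (R : realType) (dX : measure_display) (X : measurableType dX)
    (D : probability X R) (d : nat) (f : X -> 'rV[R]_d) (c : 'rV[R]_d) : Prop :=
  forall j, D.-integrable setT (fun x => (f x ord0 j)%:E) /\
            'E_D[(fun x => f x ord0 j)]%E = (c ord0 j)%:E.

(* The samples used in K iterations: measurable, of law D, and mutually
   independent (A k = setT gives the product rule for subfamilies). *)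
Definition iid_samples (R : realType) (dO dX : measure_display)
    (O : measurableType dO) (P : probability O R) (X : measurableType dX)
    (D : probability X R) (K : nat) (xi : nat -> O -> X) : Prop :=
  [/\ forall k, (k < K)%N -> measurable_fun setT (xi k),
      forall k, (k < K)%N -> forall A, measurable A -> P (xi k @^-1` A) = D A
    & forall A : nat -> set X, (forall k, measurable (A k)) ->
        P (\bigcap_(k in `I_K) (xi k @^-1` A k)) =
        (\prod_(k < K) P (xi k @^-1` A k))%E].

(* u solves the proximal variational inequality from z, with the sampled
   operator A = F(., xi^k). *)
Definition paus_extragradient (R : realType) (d : nat) (Z : set 'rV[R]_d)
    (g : 'rV[R]_d -> R) (gw : 'rV[R]_d -> 'rV[R]_d)
    (F1 A : 'rV[R]_d -> 'rV[R]_d) (gamma : R) (z u : 'rV[R]_d) : Prop :=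
  Z u /\ forall x, Z x ->
    0 <= dotv (gamma *: (F1 u + A z - F1 z) + gw u - gw z) (x - u)
         + gamma * (g x - g u).

Definition paus_update (R : realType) (d : nat) (Z : set 'rV[R]_d)
    (w : 'rV[R]_d -> R) (gw : 'rV[R]_d -> 'rV[R]_d)
    (F1 A : 'rV[R]_d -> 'rV[R]_d) (gamma alpha : R)
    (z u zn : 'rV[R]_d) : Prop :=
  let obj x := gamma * dotv (A u - F1 u - A z + F1 z) x
               + (1 + alpha) * bregman w gw x u in
  Z zn /\ forall x, Z x -> obj zn <= obj x.

(* A run of K iterations from z0, for the realized samples x 0, ..., x K.-1. *)
Definition paus_run (R : realType) (d : nat) (X : Type) (Z : set 'rV[R]_d)
    (g w : 'rV[R]_d -> R) (gw F1 : 'rV[R]_d -> 'rV[R]_d)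
    (G : 'rV[R]_d -> X -> 'rV[R]_d) (gamma alpha : R) (K : nat)
    (z0 : 'rV[R]_d) (x : nat -> X) (z u : nat -> 'rV[R]_d) : Prop :=
  z 0%N = z0 /\
  forall k, (k < K)%N ->
    paus_extragradient Z g gw F1 (G ^~ (x k)) gamma (z k) (u k) /\
    paus_update Z w gw F1 (G ^~ (x k)) gamma alpha (z k) (u k) (z k.+1).

(* Main.v *)
Require Import Defs.
From HB Require Import structures.
From mathcomp Require Import all_boot all_order all_algebra.
From mathcomp Require Import all_classical all_reals all_analysis.
From mathcomp Require Import measurable_realfun ring lra.

Import Order.TTheory GRing.Theory Num.Theory.
Import numFieldNormedType.Exports.

Local Open Scope classical_set_scope.
Local Open Scope ring_scope.

(** The proof has a deterministic part and a probabilistic one.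

    For a fixed sample, both inner problems of an iteration are variational
    inequalities: the extragradient point solves one by definition, and the new
    iterate satisfies the optimality condition of its minimization problem
    ([paus_update_vi]). Testing them at the solution, using the three-point
    identity of the Bregman divergence, strong monotonicity, similarity and two
    Young inequalities gives, with t = gamma mu / 2 and noise
    q = G(zs, xi) - F(zs),
      (1 + t) V(zs, z+) <= V(zs, z) + 2/3 gamma^2 dual_norm(q)^2 - gamma <q, z - zs>
    ([paus_descent]). The choice of alpha makes the terms in V(zs, u) cancel.

    It remains to take expectations ([expected_contraction]). The squared noise
    has mean at most sigma^2. The last term has mean zero, because z is a function
    of the earlier samples, which are independent of the current one
    ([noise_centered]). Dividing by 1 + t turns the factor 1 into at most 1 - t/2,
    as t <= 1.

    The delicate point is that a run is specified sample by sample: before using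
    the additivity of the integral or independence, one has to prove that z k is
    measurable with respect to the first k samples ([paus_iterate_adapted]). By
    strong monotonicity, the solution of each inner problem is a Lipschitz function
    of its datum ([measurable_vi_solution]); the datum is measurable since the
    operator gap F1 - G(., x) is measurable in x and Lipschitz in its first argument
    ([caratheodory_measurable]), and since the gradient of w acts on differences of
    points of Z as a limit of difference quotients
    ([measurable_gradient_representative]). Independence passes from cylinders of
    samples to the sigma-algebra that they generate ([past_independent]). *)

(** * Norms on R^d and their duals *)
Section dot_product.
Set Implicit Arguments.
Unset Strict Implicit.
Context {R : realType} {d : nat}.
Implicit Types (u v s : 'rV[R]_d).

Lemma dotvC u v : dotv u v = dotv v u.
Proof. by apply: eq_bigr => j _; rewrite mulrC. Qed.

Lemma dotvDl u v s : dotv (u + v) s = dotv u s + dotv v s.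
Proof. by rewrite -big_split; apply: eq_bigr => j _; rewrite !mxE mulrDl. Qed.

Lemma dotvZl a u s : dotv (a *: u) s = a * dotv u s.
Proof. by rewrite /dotv mulr_sumr; apply: eq_bigr => j _; rewrite !mxE mulrA. Qed.

Lemma dotvNl u s : dotv (- u) s = - dotv u s.
Proof. by rewrite -scaleN1r dotvZl mulN1r. Qed.

Lemma dotvBl u v s : dotv (u - v) s = dotv u s - dotv v s.
Proof. by rewrite dotvDl dotvNl. Qed.

Lemma dotvDr u v s : dotv s (u + v) = dotv s u + dotv s v.
Proof. by rewrite dotvC dotvDl !(dotvC s). Qed.

Lemma dotvZr a u s : dotv s (a *: u) = a * dotv s u.
Proof. by rewrite dotvC dotvZl (dotvC s). Qed.

Lemma dotvNr u s : dotv s (- u) = - dotv s u.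
Proof. by rewrite dotvC dotvNl (dotvC s). Qed.

Lemma dotvBr u v s : dotv s (u - v) = dotv s u - dotv s v.
Proof. by rewrite dotvDr dotvNr. Qed.

Lemma dotv_delta s j : dotv s (delta_mx ord0 j) = s ord0 j.
Proof.
rewrite /dotv (bigD1 j) //= mxE !eqxx mulr1 big1 ?addr0 // => i /negPf ij.
by rewrite mxE ij andbF mulr0.
Qed.

Lemma coord_le_norm s j : `|s ord0 j| <= `|s|.
Proof.
rewrite [leRHS]/Num.norm /= mx_normrE; apply/bigmax_geP; right => /=.
by exists (ord0, j).
Qed.

Lemma norm_le_coord s (c : R) :
  0 <= c -> (forall j, `|s ord0 j| <= c) -> `|s| <= c.
Proof.
move=> c0 sc; rewrite [leLHS]/Num.norm /= mx_normrE; apply/bigmax_leP.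
by split=> // -[i j] _ /=; rewrite ord1.
Qed.

Lemma norm_lt_coord s (c : R) :
  0 < c -> (forall j, `|s ord0 j| < c) -> `|s| < c.
Proof.
move=> c0 sc; rewrite [ltLHS]/Num.norm /= mx_normrE; apply/bigmax_ltP.
by split=> // -[i j] _ /=; rewrite ord1.
Qed.

Lemma dotv_le_norm u v : `|dotv u v| <= d%:R * `|u| * `|v|.
Proof.
apply: (le_trans (ler_norm_sum _ _ _)).
apply: (@le_trans _ _ (\sum_(j < d) `|u| * `|v|)).
  apply: ler_sum => j _; rewrite normrM; apply: ler_pM => //; exact: coord_le_norm.
by rewrite sumr_const card_ord -mulrA mulr_natl.
Qed.

End dot_product.

Section norms.
Set Implicit Arguments.
Unset Strict Implicit.
Context {R : realType} {d : nat} {N : 'rV[R]_d -> R} (hN : is_norm N).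
Implicit Types (x s t : 'rV[R]_d).

Lemma is_norm0 : N 0 = 0.
Proof. by rewrite -(scale0r 0) (norm_homog hN) normr0 mul0r. Qed.

Lemma is_normN x : N (- x) = N x.
Proof. by rewrite -scaleN1r (norm_homog hN) normrN1 mul1r. Qed.

Lemma is_norm_ge0 x : 0 <= N x.
Proof.
have := norm_triangle hN x (- x); rewrite subrr is_norm0 is_normN; lra.
Qed.

Lemma is_norm_upper : exists2 C : R, 0 < C & forall x, N x <= C * `|x|.
Proof.
exists (1 + \sum_(j < d) N (delta_mx ord0 j)).
  by rewrite ltr_pwDl // sumr_ge0 // => j _; exact: is_norm_ge0.
move=> x.
have sumN (s : seq 'I_d) (f : 'I_d -> 'rV[R]_d) :
    N (\sum_(j <- s) f j) <= \sum_(j <- s) N (f j).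
  elim: s => [|j s IH]; first by rewrite !big_nil is_norm0.
  by rewrite !big_cons (le_trans (norm_triangle hN _ _)) // lerD2l.
rewrite {1}(row_sum_delta x); apply: (le_trans (sumN _ _)).
rewrite mulrDl mul1r mulr_suml ler_wpDl // ler_sum // => j _.
rewrite (norm_homog hN) mulrC; apply: ler_wpM2l; first exact: is_norm_ge0.
exact: coord_le_norm.
Qed.

(** Every norm is continuous, by the previous bound, so it has a positive minimum
    on the unit sphere of the sup norm, which is compact. *)
Lemma is_norm_lower : exists2 c : R, 0 < c & forall x, c * `|x| <= N x.
Proof.
have [C C0 NC] := is_norm_upper.
pose S := [set x : 'rV[R]_d | `|x| = 1].
have [S0|/set0P S0] := eqVneq S set0.
  exists 1 => // x; have [->|x0] := eqVneq x 0.
    by rewrite normr0 mulr0 is_norm0.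
  have : S (`|x|^-1 *: x).
    by rewrite /S /= normrZ normfV normr_id mulVf // normr_eq0.
  by rewrite S0.
have cN : continuous N.
  move=> x; apply/(cvgrPdist_lt (FF := nbhs_filter x)) => e e0.
  apply: filterS (nbhsx_ballx x _ (divr_gt0 e0 C0)) => y.
  rewrite -ball_normE /= => xy.
  have h1 : N x <= N y + N (x - y).
    by rewrite -{1}(subrK y x) addrC (norm_triangle hN).
  have h2 : N y <= N x + N (x - y).
    by rewrite -{1}(subrK x y) addrC -(is_normN (x - y)) opprB (norm_triangle hN).
  have h3 : N (x - y) < e.
    apply: (le_lt_trans (NC _)); rewrite mulrC -ltr_pdivlMr //.
  by rewrite ltr_norml; apply/andP; split; lra.
have cS : compact S.
  apply: bounded_closed_compact.
    by exists 1; split => // M M1 x /= ->; exact: ltW.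
  have -> : S = (fun x : 'rV[R]_d => `|x|) @^-1` [set 1] by [].
  by apply: closed_comp => [x _|]; [exact: norm_continuous|exact: closed_eq].
have [m /set_mem mS mmin] := EVT_min_rV S0 cS (continuous_subspaceT cN).
have m0 : 0 < N m.
  rewrite lt_def is_norm_ge0 andbT; apply/eqP => /(norm_definite hN) m0.
  by move: mS; rewrite /S /= m0 normr0 => /esym/eqP; rewrite oner_eq0.
exists (N m) => // x; have [->|x0] := eqVneq x 0.
  by rewrite normr0 mulr0 is_norm0.
have := mmin (`|x|^-1 *: x).
rewrite inE /S /= normrZ normfV normr_id mulVf ?normr_eq0 // => /(_ erefl).
rewrite (norm_homog hN) normfV normr_id.
by rewrite mulrC ler_pdivlMr // normr_gt0.
Qed.

(** A [sup] only has its meaning on bounded sets: this is what makes the dual norm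
    a genuine upper bound of the pairings. *)
Lemma dual_norm_ubound s : has_ubound [set dotv s x | x in [set x | N x = 1]].
Proof.
have [c c0 Nc] := is_norm_lower.
exists (d%:R * `|s| * c^-1) => _ [x /= x1 <-].
apply: (le_trans (ler_norm _)); apply: (le_trans (dotv_le_norm _ _)).
have xc : `|x| <= c^-1 by rewrite -div1r ler_pdivlMr // mulrC (le_trans (Nc x)) ?x1.
by apply: ler_wpM2l => //; rewrite mulr_ge0.
Qed.

Lemma dual_norm_ge0 s : 0 <= dual_norm N s.
Proof.
rewrite /dual_norm; set A := (X in sup X).
have [->|/set0P[_ [x /= x1 _]]] := eqVneq A set0; first by rewrite sup0.
have h1 : dotv s x <= sup A by apply: ub_le_sup; [exact: dual_norm_ubound|exists x].
have h2 : dotv s (- x) <= sup A.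
  by apply: ub_le_sup; [exact: dual_norm_ubound|exists (- x) => //=; rewrite is_normN].
by move: h2; rewrite dotvNr; lra.
Qed.

Lemma dotv_le_dual s x : dotv s x <= dual_norm N s * N x.
Proof.
have [->|x0] := eqVneq x 0.
  by rewrite is_norm0 mulr0 -(scale0r 0) dotvZr mul0r.
have Nx0 : 0 < N x.
  rewrite lt_def is_norm_ge0 andbT; apply/eqP => /(norm_definite hN) e.
  by rewrite e eqxx in x0.
rewrite -ler_pdivrMr // mulrC -dotvZr; apply: ub_le_sup.
  exact: dual_norm_ubound.
exists ((N x)^-1 *: x) => //=.
by rewrite (norm_homog hN) ger0_norm ?invr_ge0 ?(ltW Nx0) // mulVf // gt_eqF.
Qed.

(** Each coordinate of [s] is its pairing with a basis vector, whose norm is at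
    most a fixed constant. Estimates in the dual norm become estimates on coordinates, the only
    quantities for which measurability is defined below. *)
Lemma norm_le_dual : exists2 C : R, 0 < C & forall s, `|s| <= C * dual_norm N s.
Proof.
pose C := 1 + \sum_(j < d) N (delta_mx ord0 j).
have S0 (i : 'I_d) : N (delta_mx ord0 i) <= C.
  rewrite /C (bigD1 i) //= addrCA ler_wpDr //.
  by rewrite addr_ge0 // sumr_ge0 // => k _; exact: is_norm_ge0.
have C0 : 0 < C by rewrite ltr_pwDl // sumr_ge0 // => k _; exact: is_norm_ge0.
exists C => // s; apply: norm_le_coord.
  by rewrite mulr_ge0 ?dual_norm_ge0 // ltW.
move=> j.
have le1 : dual_norm N s * N (delta_mx ord0 j) <= C * dual_norm N s.
  by rewrite mulrC; apply: ler_wpM2r; [exact: dual_norm_ge0|exact: S0].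
rewrite ler_norml lerNl -!(dotv_delta s j) -dotvNr; apply/andP; split.
  by apply: le_trans le1; rewrite -(is_normN (delta_mx _ _)); exact: dotv_le_dual.
by apply: le_trans le1; exact: dotv_le_dual.
Qed.

(** Used only to see that the dual norm of a measurable vector is measurable. *)
Lemma dual_norm_lipschitz :
  exists2 C : R, 0 < C & forall s t,
    `|dual_norm N s - dual_norm N t| <= C * `|s - t|.
Proof.
have [c c0 Nc] := is_norm_lower.
exists (1 + d%:R * c^-1); first by rewrite ltr_pwDl // mulr_ge0 // invr_ge0 ltW.
suff H s t : dual_norm N s <= dual_norm N t + (1 + d%:R * c^-1) * `|s - t|.
  move=> s t; have := H s t; have := H t s; rewrite (distrC t s) => h1 h2.
  by rewrite ler_norml; apply/andP; split; lra.
set e := (1 + _) * _.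
have e0 : 0 <= e by rewrite mulr_ge0 // addr_ge0 // mulr_ge0 // invr_ge0 ltW.
have ge0 := dual_norm_ge0 t.
rewrite {1}/dual_norm; set A := (X in sup X).
have [->|/set0P A0] := eqVneq A set0; first by rewrite sup0; lra.
apply: ge_sup => // _ [x /= x1 <-].
rewrite -{1}(subrK t s) addrC dotvDl; apply: lerD.
  by rewrite (le_trans (dotv_le_dual _ _)) // x1 mulr1.
apply: (le_trans (ler_norm _)); apply: (le_trans (dotv_le_norm _ _)).
have xc : `|x| <= c^-1 by rewrite -div1r ler_pdivlMr // mulrC (le_trans (Nc x)) ?x1.
apply: (@le_trans _ _ (d%:R * `|s - t| * c^-1)); first by rewrite ler_wpM2l.
rewrite /e mulrDl mul1r mulrAC lerDr //.
Qed.

End norms.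

(** * The gradient of a distance generating function along a convex set *)
Section distance_generating_functions.
Set Implicit Arguments.
Unset Strict Implicit.
Context {R : realType} {d : nat} {Z : set 'rV[R]_d}.
Context {w : 'rV[R]_d -> R} {gw : 'rV[R]_d -> 'rV[R]_d}.
Implicit Types (x u v z : 'rV[R]_d).

Lemma convex_segment x z (t : R) :
  convex_set Z -> 0 <= t -> t <= 1 -> Z x -> Z z -> Z (z + t *: (x - z)).
Proof.
move=> cZ t0 t1 Zx Zz.
have t01 : 0 <= t <= 1 by rewrite t0.
have := cZ x z (Itv01 t0 t1) (mem_set Zx) (mem_set Zz); rewrite inE.
congr (Z _); rewrite /conv /= scalerBr scalerBl scale1r.
by rewrite addrCA.
Qed.

Lemma gradient_ball : is_gradient_on Z w gw -> forall u, Z u ->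
  forall e : R, 0 < e -> exists2 r : R, 0 < r &
    forall v, Z v -> `|v - u| < r ->
      `|w v - w u - dotv (gw u) (v - u)| <= e * `|v - u|.
Proof.
move=> dw u Zu e e0.
have := dw u Zu e e0; rewrite near_withinE => /nbhs_ballP[r /= r0 H].
exists r => // v Zv vr; apply: H => //.
by rewrite -ball_normE /= distrC.
Qed.

Lemma gradient_continuous : is_gradient_on Z w gw -> forall u, Z u ->
  forall e : R, 0 < e -> exists2 r : R, 0 < r &
    forall v, Z v -> `|v - u| < r -> `|w v - w u| < e.
Proof.
move=> dw u Zu e e0.
have [r r0 H] := gradient_ball dw Zu (@ltr01 R).
set c := d%:R * `|gw u| + 1.
have c0 : 0 < c by rewrite ltr_wpDl // mulr_ge0.
exists (Order.min r (e / c)); first by rewrite lt_min r0 divr_gt0.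
move=> v Zv; rewrite lt_min => /andP[vr].
rewrite ltr_pdivlMr // => ve; apply: le_lt_trans ve.
rewrite -{1}(subrK (dotv (gw u) (v - u)) (w v - w u)).
rewrite (le_trans (ler_normD _ _)) // mulrC mulrDl addrC lerD //.
- exact: dotv_le_norm.
- exact: H.
Qed.

(** By convexity the quotients only evaluate [w] on [Z], so this holds even where
    [Z] has no interior. It serves twice: to derive the optimality condition of a
    minimizer, and to exhibit the pairings of [gw] as limits of measurable
    functions. *)
Lemma gradient_directional : is_gradient_on Z w gw -> convex_set Z ->
  forall z x, Z z -> Z x ->
  (fun n => n.+1%:R * (w (z + n.+1%:R^-1 *: (x - z)) - w z)) @ \oo
    --> dotv (gw z) (x - z).
Proof.
move=> dw cZ z x Zz Zx; apply/cvgrPdist_le => e e0.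
set h := x - z.
have h1 : 0 < `|h| + 1 by rewrite ltr_wpDl.
have [r r0 H] := gradient_ball dw Zz (divr_gt0 e0 h1).
near=> n.
have n0 : 0 < n.+1%:R :> R by [].
have := H (z + n.+1%:R^-1 *: h).
rewrite addrAC subrr add0r normrZ (ger0_norm (ltW _)) ?invr_gt0 //.
have Zn : Z (z + n.+1%:R^-1 *: h).
  by apply: convex_segment => //; rewrite ?invr_ge0 // invf_le1 // ler1n.
move=> /(_ Zn) Hn.
have rn : n.+1%:R^-1 * `|h| < r.
  rewrite mulrC ltr_pdivrMr // mulrC -ltr_pdivrMr //.
  apply: (@lt_le_trans _ _ n%:R); last by rewrite ler_nat.
  by near: n; exact: nbhs_infty_gtr.
have {Hn} := Hn rn; rewrite dotvZr => Hn.
rewrite distrC.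
have -> : n.+1%:R * (w (z + n.+1%:R^-1 *: h) - w z) - dotv (gw z) h
   = n.+1%:R * (w (z + n.+1%:R^-1 *: h) - w z - n.+1%:R^-1 * dotv (gw z) h).
  by rewrite [RHS]mulrBr mulVKf // gt_eqF.
rewrite normrM gtr0_norm //.
apply: (@le_trans _ _ (n.+1%:R * (e / (`|h| + 1) * (n.+1%:R^-1 * `|h|)))).
  by rewrite ler_wpM2l.
rewrite mulrCA mulVKf ?gt_eqF // mulrAC ler_pdivrMr // ler_wpM2l ?(ltW e0) //.
by rewrite lerDl.
Unshelve. all: by end_near.
Qed.

End distance_generating_functions.

(** * The descent inequality of one iteration *)
Section paus_step.
Set Implicit Arguments.
Unset Strict Implicit.
Context {R : realType} {d : nat} {Z : set 'rV[R]_d} {N : 'rV[R]_d -> R}.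
Context {w : 'rV[R]_d -> R} {gw : 'rV[R]_d -> 'rV[R]_d}.
Hypotheses (hN : is_norm N) (dgf : distance_generating N Z w gw).
Implicit Types (x u v z : 'rV[R]_d).
Let V := bregman w gw.

Lemma bregman_ge u v : Z u -> Z v -> 2^-1 * N (u - v) ^+ 2 <= V u v.
Proof. by move=> Zu Zv; have := dgf.2 v u Zv Zu; rewrite /V /bregman; lra. Qed.

Lemma bregman_ge0 u v : Z u -> Z v -> 0 <= V u v.
Proof.
by move=> Zu Zv; rewrite (le_trans _ (bregman_ge Zu Zv)) // mulr_ge0 // sqr_ge0.
Qed.

Lemma gradient_strongly_monotone u v :
  Z u -> Z v -> N (u - v) ^+ 2 <= dotv (gw u - gw v) (u - v).
Proof.
move=> Zu Zv; have := bregman_ge Zu Zv; have := bregman_ge Zv Zu.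
rewrite /V /bregman -(is_normN hN (v - u)) opprB dotvBl.
by rewrite -(opprB u v) dotvNr; lra.
Qed.

Lemma bregman_three_points x u z :
  dotv (gw u - gw z) (x - u) = V x z - V x u - V u z.
Proof. by rewrite /V /bregman dotvBl !dotvBr; ring. Qed.

(** First-order optimality. Moving from the minimizer [zn] towards [x] by a
    fraction 1/(n+1) of the segment cannot decrease the objective; the increment
    multiplied by n+1 tends to the right-hand side. *)
Lemma paus_update_vi (F1 A : 'rV[R]_d -> 'rV[R]_d) (gamma alpha : R) z u zn :
  convex_set Z -> paus_update Z w gw F1 A gamma alpha z u zn ->
  forall x, Z x ->
    0 <= dotv (gamma *: (A u - F1 u - A z + F1 z)
               + (1 + alpha) *: (gw zn - gw u)) (x - zn).
Proof.
move=> cZ [Zzn opt] x Zx.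
set c := A u - F1 u - A z + F1 z; set h := x - zn.
have lim := gradient_directional dgf.1 cZ Zzn Zx.
pose f n := gamma * dotv c h + (1 + alpha) *
  (n.+1%:R * (w (zn + n.+1%:R^-1 *: h) - w zn) - dotv (gw u) h).
have fl : f n @[n --> \oo] -->
    gamma * dotv c h + (1 + alpha) * (dotv (gw zn) h - dotv (gw u) h).
  by apply: cvgD; [exact: cvg_cst|apply: cvgMr; apply: cvgB => //; exact: cvg_cst].
rewrite dotvDl !dotvZl dotvBl -(cvg_lim _ fl) //.
apply: limr_ge; first by apply/cvg_ex; eexists; exact: fl.
near=> n.
have n0 : 0 < n.+1%:R :> R by [].
have Zn : Z (zn + n.+1%:R^-1 *: h).
  by apply: convex_segment => //; rewrite ?invr_ge0 // invf_le1 // ler1n.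
have := opt _ Zn; rewrite -/c -subr_ge0 => H.
have {H} := mulr_ge0 (ltW n0) H; congr (0 <= _).
rewrite /f /bregman; clearbody h.
rewrite -[zn + _ - u]addrAC !dotvDr !dotvZr.
by field; rewrite gt_eqF.
Unshelve. all: by end_near.
Qed.

(** Add the two variational inequalities satisfied by [u] and [zn], both tested at
    [zs], to the one satisfied by [zs], tested at [u], and turn gradient pairings
    into divergences. The operator terms recombine into
    [- <A u - A zs, u - zs>], whose strong monotonicity pays for
    [alpha * V zs u]: this is why [alpha] is [gamma * mu / 2]. What remains is the
    correction term [<p, u - zn>], with [p] the operator of the update of [zn],
    which similarity makes quadratic, and the noise term [- <q, u - zs>], where
    [q] is [A zs - F zs]. The latter is split at [z], because only
    [<q, z - zs>] will have zero mean: [u] depends on the current sample. *)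
Lemma paus_descent (F F1 A : 'rV[R]_d -> 'rV[R]_d) (g : 'rV[R]_d -> R)
    (gamma mu delta : R) (zs z u zn : 'rV[R]_d) :
  convex_set Z -> vi_solution Z F g zs ->
  0 < delta -> lipschitz_dual_on N Z delta (fun v => F1 v - A v) ->
  0 <= mu -> strongly_monotone_on Z w gw mu A ->
  0 < gamma -> gamma <= (2 * delta)^-1 -> Z z ->
  paus_extragradient Z g gw F1 A gamma z u ->
  paus_update Z w gw F1 A gamma (gamma * mu / 2) z u zn ->
  (1 + gamma * mu / 2) * V zs zn <=
    V zs z + 2 * gamma ^+ 2 / 3 * dual_norm N (A zs - F zs) ^+ 2
    - gamma * dotv (A zs - F zs) (z - zs).
Proof.
move=> cZ [Zzs sol] d0 lip mu0 smon g0 gle Zz [Zu eg] upd.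
have Zzn := upd.1.
have gd : gamma * delta <= 2^-1.
  have := ler_wpM2r (ltW d0) gle.
  by rewrite invfM -mulrA mulVf ?mulr1 // gt_eqF.
set alpha := gamma * mu / 2 in upd *.
have alpha0 : 0 <= alpha by rewrite /alpha divr_ge0 // mulr_ge0 // ltW.
set p := A u - F1 u - A z + F1 z.
set q := A zs - F zs.
have step1 : 0 <= gamma * dotv (A u - p) (zs - u)
    + (V zs z - V zs u - V u z) + gamma * (g zs - g u).
  have := eg _ Zzs => H.
  rewrite -(addrA _ (gw u)) dotvDl dotvZl bregman_three_points in H.
  move: H; by congr (0 <= gamma * dotv _ _ + _ + _); apply/rowP => j; rewrite !mxE; ring.
have step2 : 0 <= gamma * dotv p (zs - zn)
    + (1 + alpha) * (V zs u - V zs zn - V zn u).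
  have := paus_update_vi cZ upd Zzs => H.
  by rewrite dotvDl !dotvZl bregman_three_points in H.
have step3 : 0 <= dotv (F zs) (u - zs) + g u - g zs := sol _ Zu.
have step4 := smon u zs Zu Zzs.
have step5 : dotv p (u - zn) <= delta * N (u - z) * N (zn - u).
  have -> : dotv p (u - zn) =
      dotv (F1 u - A u - (F1 z - A z)) (zn - u).
    rewrite -(opprB u zn) dotvNr -dotvNl; congr dotv.
    by apply/rowP => j; rewrite !mxE; ring.
  apply: (le_trans (dotv_le_dual hN _ _)).
  by apply: ler_wpM2r; [exact: is_norm_ge0|exact: lip].
have step6 : - dotv q (u - z) <= dual_norm N q * N (u - z).
  by rewrite -dotvNr -(is_normN hN (u - z)); exact: dotv_le_dual.
have Vuz := bregman_ge Zu Zz.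
have Vznu := bregman_ge Zzn Zu.
have Vuzs := bregman_ge0 Zu Zzs.
have a0 := is_norm_ge0 hN (u - z).
have b0 := is_norm_ge0 hN (zn - u).
have n0 := dual_norm_ge0 hN q.
move: step1 step2 step3 step4 step5 step6 Vuz Vznu a0 b0 n0.
rewrite -/V; set a := N (u - z); set b := N (zn - u); set n := dual_norm N q.
move=> step1 step2 step3 step4 step5 step6 Vuz Vznu a0 b0 n0.
(* The terms [- V zn u] and [- V u z] provide [- b^2/2] and [- a^2/2]. The first
   Young inequality spends all of the former and [a^2/8] of the latter, leaving
   exactly the [3/8 a^2] that the second one needs. *)
have young1 : gamma * (delta * a * b) <= a ^+ 2 / 8 + b ^+ 2 / 2.
  have := sqr_ge0 (a - 2 * b).
  have := ler_wpM2r (mulr_ge0 a0 b0) gd; lra.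
have young2 : gamma * (n * a) <= 3 / 8 * a ^+ 2 + 2 * gamma ^+ 2 / 3 * n ^+ 2.
  by have := sqr_ge0 (3 * a - 4 * (gamma * n)); lra.
have Vznu1 : b ^+ 2 / 2 <= (1 + alpha) * V zn u.
  rewrite mulrDl mul1r; have := mulr_ge0 alpha0 (bregman_ge0 Zzn Zu); lra.
have {}step3 := mulr_ge0 (ltW g0) step3.
have {}step4 := ler_wpM2l (ltW g0) step4.
have {}step5 := ler_wpM2l (ltW g0) step5.
have {}step6 := ler_wpM2l (ltW g0) step6.
have aV : 0 <= alpha * V u zs by rewrite mulr_ge0.
have step4' : alpha * V u zs + alpha * V zs u
    <= gamma * dotv (A u - A zs) (u - zs).
  by apply: le_trans step4; rewrite /alpha /V; lra.
move: step1 step2 step3 step4' step5 step6.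
rewrite /q !(dotvBl, dotvBr); lra.
Qed.

End paus_step.

(** * Measurability of vector-valued maps *)
Section measurability_coordinates.
Set Implicit Arguments.
Unset Strict Implicit.
Context {R : realType} {dT : measure_display} {T : measurableType dT} {d : nat}.
Implicit Types (b y : T -> 'rV[R]_d).

(** Measurability for the Borel sets of R^d, expressed by coordinates. *)
Definition measurable_coords b :=
  forall j, measurable_fun setT (fun t => b t ord0 j).

Lemma measurable_coordsD b y : measurable_coords b -> measurable_coords y ->
  measurable_coords (fun t => b t + y t).
Proof.
move=> mb my j; under eq_fun do rewrite mxE.
exact: measurable_funD.
Qed.

Lemma measurable_coordsZ (a : R) b : measurable_coords b ->
  measurable_coords (fun t => a *: b t).
Proof.
move=> mb j; under eq_fun do rewrite mxE.
by apply: measurable_funM => //; exact: measurable_cst.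
Qed.

Lemma measurable_coordsB b y : measurable_coords b -> measurable_coords y ->
  measurable_coords (fun t => b t - y t).
Proof.
move=> mb my; under eq_fun do rewrite -scaleN1r.
by apply: measurable_coordsD => //; exact: measurable_coordsZ.
Qed.

Lemma measurable_coords_ball b (q : 'rV[R]_d) (r : R) :
  measurable_coords b -> 0 < r -> measurable [set t | `|b t - q| < r].
Proof.
move=> mb r0.
have -> : [set t | `|b t - q| < r]
    = \bigcap_(j in [set: 'I_d]) [set t | `|b t ord0 j - q ord0 j| < r].
  apply/seteqP; split=> t /= tr.
    move=> j _ /=; apply: le_lt_trans tr.
    by have := coord_le_norm (b t - q) j; rewrite !mxE.
  by apply: norm_lt_coord => // j; rewrite !mxE; exact: tr.
apply: fin_bigcap_measurable; first exact: finite_finset.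
move=> j _; rewrite -[X in measurable X]setTI.
have m : measurable_fun setT (fun t => `|b t ord0 j - q ord0 j|).
  apply: measurableT_comp => //; apply: measurable_funB => //.
have := m measurableT _ (measurable_itv `]-oo, r[).
by congr (measurable (_ `&` _)); apply/seteqP; split=> t /=; rewrite in_itv.
Qed.

Lemma rational_near (v : 'rV[R]_d) (r : R) : 0 < r ->
  exists q : 'rV[rat]_d, `|v - map_mx ratr q| < r.
Proof.
move=> r0.
have H j : exists q : rat, `|v ord0 j - ratr q| < r.
  have [|q] := @rat_in_itvoo R (v ord0 j - r) (v ord0 j + r); first lra.
  rewrite in_itv /= => /andP[q1 q2]; exists q.
  by rewrite ltr_norml; apply/andP; split; lra.
have [f fP] := choice H.
exists (\row_j f j); apply: norm_lt_coord => // j; rewrite !mxE; exact: fP.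
Qed.

(** The hypothesis says that [h] is a continuous function of [b], on the range of
    [b]. A set [a < h] is then the preimage under [b] of an open set, hence a
    countable union of preimages of rational balls. *)
Lemma measurable_fun_factor b (h : T -> R) : measurable_coords b ->
  (forall t (e : R), 0 < e -> exists2 r : R, 0 < r &
    forall t', `|b t' - b t| < r -> `|h t' - h t| < e) ->
  measurable_fun setT h.
Proof.
move=> mb hb _; apply: (measurability _ (RGenOInfty.measurableE R)) => //.
move=> _ [_ [a ->] <-]; rewrite setTI.
set S := h @^-1` _.
pose B (i : 'rV[rat]_d * nat) :=
  [set t | `|b t - map_mx ratr i.1| < i.2.+1%:R^-1].
pose F i := if `[< B i `<=` S >] then B i else set0.
have -> : S = \bigcup_i F i.
  apply/seteqP; split=> [t|t [i _]]; last first.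
    by rewrite /F; case: asboolP => // BS; exact: BS.
  rewrite /S /= in_itv /= andbT => at_.
  have [|r r0 hr] := hb t (h t - a); first by rewrite subr_gt0.
  have [n nr] : exists n, n.+1%:R^-1 < r / 2.
    have [n nr] := ltr_add_invr (divr_gt0 r0 (ltr0Sn R 1)).
    by exists n; rewrite add0r in nr.
  have n0 : 0 < n.+1%:R^-1 :> R by rewrite invr_gt0.
  have [q qt] := rational_near (b t) n0.
  exists (q, n) => //; rewrite /F; case: asboolP => // -[] t' /= Bt'.
  rewrite /S /= in_itv /= andbT.
  have tt' : `|b t' - b t| < r.
    rewrite (le_lt_trans (ler_distD (map_mx ratr q) _ _)) //.
    rewrite (distrC _ (b t)); apply: lt_trans (ltrD Bt' qt) _.
    by rewrite (splitr r) ltrD.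
  by have := hr _ tt'; rewrite ltr_norml => /andP[] /=; lra.
apply: countable_bigcupT_measurable => [|i]; first exact: countableP.
rewrite /F; case: asboolP => // _.
by apply: measurable_coords_ball => //; rewrite invr_gt0.
Qed.

Lemma measurable_coords_factor b y (C : R) : measurable_coords b -> 0 < C ->
  (forall t t', `|y t - y t'| <= C * `|b t - b t'|) -> measurable_coords y.
Proof.
move=> mb C0 yb j; apply: (measurable_fun_factor mb) => t e e0.
exists (e / C); first by rewrite divr_gt0.
move=> t'; rewrite ltr_pdivlMr // mulrC; apply: le_lt_trans.
apply: le_trans (yb _ _).
by have := coord_le_norm (y t' - y t) j; rewrite !mxE.
Qed.

End measurability_coordinates.

Section separability.
Set Implicit Arguments.
Unset Strict Implicit.
Context {R : realType} {d : nat}.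

(** For each ball with a rational centre and radius 1/(n+1) that meets [Z], keep
    one point of [Z] in it. *)
Lemma dense_sequence (Z : set 'rV[R]_d) : Z !=set0 ->
  exists2 q : nat -> 'rV[R]_d, forall n, Z (q n) &
    forall z, Z z -> forall e : R, 0 < e -> exists n, `|z - q n| < e.
Proof.
move=> [z0 Zz0].
pose near_pt (i : 'rV[rat]_d * nat) (v : 'rV[R]_d) :=
  Z v /\ `|v - map_mx ratr i.1| < i.2.+1%:R^-1.
have H i : exists v, Z v /\ ((exists v', near_pt i v') -> near_pt i v).
  have [[v nv]|nv] := pselect (exists v', near_pt i v').
    by exists v; split=> //; case: nv.
  by exists z0.
have [f fP] := choice H.
exists (fun n => if unpickle n is Some i then f i else z0).
  by move=> n; case: (unpickle n) => // i; exact: (fP i).1.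
move=> z Zz e e0.
have [n] := ltr_add_invr (divr_gt0 e0 (ltr0Sn R 1)); rewrite add0r => ne.
have n0 : 0 < n.+1%:R^-1 :> R by rewrite invr_gt0.
have [q zq] := rational_near z n0.
exists (pickle (q, n)); rewrite pickleK.
have [|_ /= fq] := (fP (q, n)).2; first by exists z.
rewrite (le_lt_trans (ler_distD (map_mx ratr q) _ _)) //.
rewrite (distrC _ (f _)); apply: lt_trans (ltrD zq fq) _.
by rewrite (splitr e) ltrD.
Qed.

End separability.

Section caratheodory.
Set Implicit Arguments.
Unset Strict Implicit.
Context {R : realType} {d : nat}.
Context {dT dX : measure_display} {T : measurableType dT} {X : measurableType dX}.

(** McShane's formula: a function that is Lipschitz in its first argument is the
    infimum of [f (q n) x + C * |v - q n|] over a dense sequence [q], and this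
    expression is measurable in both arguments jointly. *)
Lemma caratheodory_measurable (Z : set 'rV[R]_d) (f : 'rV[R]_d -> X -> R)
    (C : R) (z : T -> 'rV[R]_d) (xi : T -> X) :
  0 <= C ->
  (forall v, Z v -> measurable_fun setT (f v)) ->
  (forall x u v, Z u -> Z v -> `|f u x - f v x| <= C * `|u - v|) ->
  measurable_coords z -> (forall t, Z (z t)) -> measurable_fun setT xi ->
  measurable_fun setT (fun t => f (z t) (xi t)).
Proof.
move=> C0 mf lf mz Zz mxi.
have [Z0|/set0P Z0] := eqVneq Z set0.
  by apply: (measurable_fun_factor mz) => t; have := Zz t; rewrite Z0.
have [q Zq qd] := dense_sequence Z0.
pose h n t := f (q n) (xi t) + C * `|z t - q n|.
have hlb t n : f (z t) (xi t) <= h n t.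
  have := lf (xi t) _ _ (Zz t) (Zq n).
  by rewrite ler_norml /h => /andP[_]; lra.
have lbh t : has_lbound (range (h ^~ t)).
  by exists (f (z t) (xi t)) => _ [n _ <-]; exact: hlb.
have mh n : measurable_fun setT (h n).
  apply: measurable_funD.
    by apply: measurableT_comp => //; exact: mf.
  apply: measurable_funM; first exact: measurable_cst.
  apply: (measurable_fun_factor mz) => t e e0; exists e => // t' tt'.
  apply: le_lt_trans tt'; apply: (le_trans (ler_dist_dist _ _)).
  by rewrite opprB addrA subrK.
have -> : (fun t => f (z t) (xi t)) = (fun t => infs (h ^~ t) 0).
  apply/funext => t; rewrite /infs /sdrop /=.
  rewrite (_ : [set _ | _ in _] = range (h ^~ t)); last first.
    by apply/seteqP; split=> _ [n _ <-]; exists n.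
  apply/eqP; rewrite eq_le; apply/andP; split.
    apply: lb_le_inf; first by exists (h 0%N t); exists 0%N.
    by move=> _ [n _ <-]; exact: hlb.
  apply/ler_addgt0Pr => e e0.
  have C1 : 0 < 2 * C + 1 by lra.
  have [n zn] := qd _ (Zz t) _ (divr_gt0 e0 C1).
  apply: (@le_trans _ _ (h n t)).
    by apply: ge_inf; [exact: lbh|exists n].
  have := lf (xi t) _ _ (Zq n) (Zz t); rewrite (distrC (q n)) => H.
  move: (le_trans (ler_norm _) H) => {}H.
  move: zn; rewrite ltr_pdivlMr // => zn.
  have := normr_ge0 (z t - q n); rewrite /h; lra.
exact: measurable_fun_infs.
Qed.

End caratheodory.

Section spanning.
Set Implicit Arguments.
Unset Strict Implicit.

(** A matrix of largest rank among those with rows in [A] spans [A], since adding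
    a row outside its span would increase the rank. *)
Lemma finite_row_span {R : fieldType} {d : nat} (A : set 'rV[R]_d) :
  exists r (M : 'M[R]_(r, d)),
    (forall i, A (row i M)) /\ forall x, A x -> (x <= M)%MS.
Proof.
pose Q k := `[< exists r (M : 'M[R]_(r, d)),
  (forall i, A (row i M)) /\ \rank M = k >].
have exQ : exists k, Q k.
  by exists 0%N; apply/asboolP; exists 0%N, 0; split; [case|exact: mxrank0].
have bQ k : Q k -> (k <= d)%N.
  by move=> /asboolP[r [M [_ <-]]]; exact: rank_leq_col.
case: (ex_maxnP exQ bQ) => k /asboolP[r [M [AM rM]]] kmax.
exists r, M; split=> // x Ax.
have : (\rank (col_mx M x) <= k)%N.
  apply: kmax; apply/asboolP; exists (r + 1)%N, (col_mx M x); split=> // i.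
  have -> : row i (col_mx M x) = if fintype.split i is inl j then row j M else x.
    by apply/rowP => j; rewrite !mxE; case: fintype.split => l; rewrite ?mxE ?ord1.
  by case: fintype.split.
rewrite -rM => le_r.
have MN : (M <= col_mx M x)%MS by rewrite -addsmxE addsmxSl.
have := mxrank_leqif_sup MN => -[_].
rewrite eqn_leq le_r mxrankS // -addsmxE addsmx_sub.
by move=> /esym /andP[].
Qed.

End spanning.

(** * Measurability of gradients and of solutions of variational inequalities *)
Section bregman_measurability.
Set Implicit Arguments.
Unset Strict Implicit.
Context {R : realType} {d : nat} {Z : set 'rV[R]_d}.
Context {w : 'rV[R]_d -> R} {gw : 'rV[R]_d -> 'rV[R]_d}.
Hypotheses (dw : is_gradient_on Z w gw) (cZ : convex_set Z).
Context {dT : measure_display} {T : measurableType dT}.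
Context {z : T -> 'rV[R]_d}.
Hypotheses (mz : measurable_coords z) (Zz : forall t, Z (z t)).

Lemma measurable_potential_segment x (s : R) :
  Z x -> 0 <= s -> s <= 1 ->
  measurable_fun setT (fun t => w (z t + s *: (x - z t))).
Proof.
move=> Zx s0 s1.
have Zs t : Z (z t + s *: (x - z t)) by exact: convex_segment.
have mb : measurable_coords (fun t => z t + s *: (x - z t)).
  apply: measurable_coordsD => //; apply: measurable_coordsZ.
  by apply: measurable_coordsB => // j; exact: measurable_cst.
apply: (measurable_fun_factor mb) => t e e0.
have [r r0 H] := gradient_continuous dw (Zs t) e0.
by exists r => // t' tt'; exact: H.
Qed.

Lemma measurable_potential : measurable_fun setT (fun t => w (z t)).
Proof.
apply: (measurable_fun_factor mz) => t e e0.
have [r r0 H] := gradient_continuous dw (Zz t) e0.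
by exists r => // t' tt'; exact: H.
Qed.

(** The gradient map may be discontinuous at boundary points of [Z], but its
    pairing with a feasible direction is a limit of difference quotients of the
    continuous function [w]. *)
Lemma measurable_directional x :
  Z x -> measurable_fun setT (fun t => dotv (gw (z t)) (x - z t)).
Proof.
move=> Zx.
pose h n t := n.+1%:R * (w (z t + n.+1%:R^-1 *: (x - z t)) - w (z t)).
apply: (@measurable_fun_cvg _ _ _ _ h); last first.
  by move=> t _; exact: (gradient_directional dw cZ (Zz t) Zx).
move=> n; apply: measurable_funM; first exact: measurable_cst.
apply: measurable_funB; last exact: measurable_potential.
by apply: measurable_potential_segment; rewrite ?invr_ge0 // invf_le1 // ler1n.
Qed.

Lemma measurable_bregman x :
  Z x -> measurable_fun setT (fun t => bregman w gw x (z t)).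
Proof.
move=> Zx; apply: measurable_funB; last exact: measurable_directional.
by apply: measurable_funB; [exact: measurable_cst|exact: measurable_potential].
Qed.

(** The component of [gw] orthogonal to [Z] is arbitrary and may fail to be
    measurable. Only pairings with differences of points of [Z] matter; these are
    determined by finitely many of them, all measurable, from which a vector with
    the same pairings is recovered by a fixed linear map. *)
Lemma measurable_gradient_representative :
  exists2 b : T -> 'rV[R]_d, measurable_coords b &
    forall t x y, Z x -> Z y -> dotv (b t) (x - y) = dotv (gw (z t)) (x - y).
Proof.
have [->|/set0P[z0 Zz0]] := eqVneq Z set0.
  by exists (fun=> 0) => // j; exact: measurable_cst.
have [r [M [AM spM]]] := finite_row_span [set x - z0 | x in Z].
have dotvE (u v : 'rV[R]_d) : dotv u v = (u *m v^T) ord0 ord0.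
  by rewrite mxE; apply: eq_bigr => j _; rewrite mxE.
have rowE (u : 'rV[R]_d) i : (u *m M^T) ord0 i = dotv u (row i M).
  by rewrite mxE; apply: eq_bigr => j _; rewrite !mxE.
pose b t := gw (z t) *m M^T *m pinvmx M^T.
have bM t : b t *m M^T = gw (z t) *m M^T.
  by rewrite /b mulmxKpV // submxMl.
exists b.
  move=> j; rewrite /b; under eq_fun do rewrite mxE.
  apply: measurable_sum => i; apply: measurable_funM; last exact: measurable_cst.
  under eq_fun do rewrite rowE.
  have [x Zx xE] := AM i.
  have -> : (fun t => dotv (gw (z t)) (row i M)) =
      (fun t => dotv (gw (z t)) (x - z t) - dotv (gw (z t)) (z0 - z t)).
    by apply/funext => t; rewrite -xE !dotvBr; ring.
  by apply: measurable_funB; exact: measurable_directional.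
have H t x : Z x -> dotv (b t) (x - z0) = dotv (gw (z t)) (x - z0).
  move=> Zx; have /submxP[c ->] : (x - z0 <= M)%MS by apply: spM; exists x.
  by rewrite !dotvE trmx_mul !mulmxA bM.
move=> t x y Zx Zy.
have E v : dotv v (x - y) = dotv v (x - z0) - dotv v (y - z0).
  by rewrite !dotvBr; ring.
by rewrite !E !H.
Qed.

End bregman_measurability.

Section vi_measurability.
Set Implicit Arguments.
Unset Strict Implicit.
Context {R : realType} {d : nat} {Z : set 'rV[R]_d} {N : 'rV[R]_d -> R}.
Hypothesis hN : is_norm N.
Context {dT : measure_display} {T : measurableType dT}.

(** Testing the inequality at [y s] for the datum [b t], and conversely, strong
    monotonicity bounds [y t - y s] by a multiple of [b t - b s]: the solution is a
    Lipschitz function of the datum, and thus as measurable as the datum. *)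
Lemma measurable_vi_solution (A : 'rV[R]_d -> 'rV[R]_d) (h : 'rV[R]_d -> R)
    (c : R) (b y : T -> 'rV[R]_d) :
  0 < c ->
  (forall u v, Z u -> Z v -> c * N (u - v) ^+ 2 <= dotv (A u - A v) (u - v)) ->
  measurable_coords b -> (forall t, Z (y t)) ->
  (forall t x, Z x -> 0 <= dotv (A (y t) - b t) (x - y t) + (h x - h (y t))) ->
  measurable_coords y.
Proof.
move=> c0 mon mb Zy sol.
have [l l0 Nl] := is_norm_lower hN.
have k0 : 0 < c * l ^+ 2 by rewrite mulr_gt0 // exprn_gt0.
have C0 : 0 < (d%:R + 1) / (c * l ^+ 2) :> R by rewrite divr_gt0 // ltr_wpDl.
apply: (measurable_coords_factor mb C0) => t s.
have H : c * N (y t - y s) ^+ 2 <= dotv (b t - b s) (y t - y s).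
  have := sol t _ (Zy s); have := sol s _ (Zy t).
  have := mon _ _ (Zy t) (Zy s).
  by rewrite !(dotvBl, dotvBr); lra.
have [e0|ne0] := eqVneq `|y t - y s| 0.
  by rewrite e0 mulr_ge0 // ltW.
have p0 : 0 < `|y t - y s| by rewrite lt_def ne0 normr_ge0.
rewrite mulrAC ler_pdivlMr // -(ler_pM2r p0).
have -> : `|y t - y s| * (c * l ^+ 2) * `|y t - y s|
    = c * (l * `|y t - y s|) ^+ 2 by ring.
apply: (@le_trans _ _ (c * N (y t - y s) ^+ 2)).
  rewrite ler_pM2l // lerXn2r ?nnegrE ?is_norm_ge0 //.
  by rewrite mulr_ge0 // ltW.
apply: (le_trans H); apply: (le_trans (ler_norm _)).
apply: (le_trans (dotv_le_norm _ _)); rewrite ler_wpM2r // ler_wpM2r //.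
by rewrite lerDl.
Qed.

End vi_measurability.

(** * Measurability of one iteration *)
Section paus_step_measurability.
Set Implicit Arguments.
Unset Strict Implicit.
Context {R : realType} {d : nat} {Z : set 'rV[R]_d} {N : 'rV[R]_d -> R}.
Context {w : 'rV[R]_d -> R} {gw : 'rV[R]_d -> 'rV[R]_d}.
Hypotheses (hN : is_norm N) (dgf : distance_generating N Z w gw).
Hypothesis cZ : convex_set Z.
Context {dT dX : measure_display} {T : measurableType dT} {X : measurableType dX}.

(** To be applied to the difference [H v x] between the server operator at [v] and
    the oracle at [v] and [x]: it is Lipschitz by similarity, and the data of both
    inner problems involve the server operator and the oracle only through it. *)
Lemma measurable_oracle_gap (H : 'rV[R]_d -> X -> 'rV[R]_d) (delta : R)
    (z : T -> 'rV[R]_d) (xi : T -> X) :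
  0 < delta ->
  (forall x, lipschitz_dual_on N Z delta (H ^~ x)) ->
  (forall v, Z v -> measurable_coords (H v)) ->
  measurable_coords z -> (forall t, Z (z t)) -> measurable_fun setT xi ->
  measurable_coords (fun t => H (z t) (xi t)).
Proof.
move=> d0 lip mH mz Zz mxi j.
have [C1 C10 H1] := norm_le_dual hN.
have [C2 C20 H2] := is_norm_upper hN.
apply: (@caratheodory_measurable _ _ _ _ _ _ Z (fun v x => H v x ord0 j)
          (C1 * (delta * C2))) => //.
- by rewrite !mulr_ge0 // ltW.
- by move=> v Zv; exact: mH.
move=> x u v Zu Zv.
apply: (@le_trans _ _ `|H u x - H v x|).
  by have := coord_le_norm (H u x - H v x) j; rewrite !mxE.
apply: (le_trans (H1 _)); rewrite -!mulrA ler_pM2l //.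
apply: (le_trans (lip x u v Zu Zv)); rewrite ler_pM2l //; exact: H2.
Qed.

(** Both [u] and [zn] solve variational inequalities whose data are measurable by
    the previous lemmas. The operator of the first one is
    [gamma * F1 + gw], where the possible lack of monotonicity of [F1] is at most
    [gamma * delta <= 1/2] and is absorbed by half of the strong monotonicity
    of [gw]. *)
Lemma measurable_paus_step (g : 'rV[R]_d -> R) (F1 : 'rV[R]_d -> 'rV[R]_d)
    (G : 'rV[R]_d -> X -> 'rV[R]_d) (gamma mu delta : R)
    (z u zn : T -> 'rV[R]_d) (xi : T -> X) :
  0 < delta ->
  (forall x, lipschitz_dual_on N Z delta (fun v => F1 v - G v x)) ->
  (forall v, Z v -> measurable_coords (G v)) ->
  0 <= mu -> (forall x, strongly_monotone_on Z w gw mu (G ^~ x)) ->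
  0 < gamma -> gamma <= (2 * delta)^-1 ->
  measurable_coords z -> (forall t, Z (z t)) -> measurable_fun setT xi ->
  (forall t, paus_extragradient Z g gw F1 (G ^~ (xi t)) gamma (z t) (u t)) ->
  (forall t, paus_update Z w gw F1 (G ^~ (xi t)) gamma (gamma * mu / 2)
               (z t) (u t) (zn t)) ->
  measurable_coords zn.
Proof.
move=> d0 lip mG mu0 smon g0 gle mz Zz mxi eg upd.
have gd : gamma * delta <= 2^-1.
  have := ler_wpM2r (ltW d0) gle.
  by rewrite invfM -mulrA mulVf ?mulr1 // gt_eqF.
set alpha := gamma * mu / 2 in upd.
have alpha0 : 0 <= alpha by rewrite /alpha divr_ge0 // mulr_ge0 // ltW.
pose H v x := F1 v - G v x.
have mH v : Z v -> measurable_coords (H v).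
  move=> Zv; apply: measurable_coordsB; last exact: mG.
  by move=> j; exact: measurable_cst.
have Zu t : Z (u t) := (eg t).1.
have mHz := measurable_oracle_gap d0 lip mH mz Zz mxi.
have mu_ : measurable_coords u.
  have [b mb bE] := measurable_gradient_representative dgf.1 cZ mz Zz.
  apply: (@measurable_vi_solution _ _ Z _ hN _ _
    (fun v => gamma *: F1 v + gw v) (fun v => gamma * g v) 2^-1
    (fun t => b t + gamma *: H (z t) (xi t))) => //.
  (* The sample [point] is arbitrary: the operator [F1] does not depend on it, and
     is written as the gap plus the oracle at that sample. *)
  - move=> v v' Zv Zv'.
    have l1 : dotv (H v' point - H v point) (v - v') <= delta * N (v - v') ^+ 2.
      apply: (le_trans (dotv_le_dual hN _ _)).
      rewrite expr2 mulrA; apply: ler_wpM2r; first exact: is_norm_ge0.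
      by rewrite -(is_normN hN (v - v')) (opprB v v'); exact: (lip point _ _ Zv' Zv).
    have l2 := gradient_strongly_monotone hN dgf Zv Zv'.
    have l3 : 0 <= dotv (G v point - G v' point) (v - v').
      apply: le_trans (smon point v v' Zv Zv').
      by rewrite mulr_ge0 ?divr_ge0 // addr_ge0 // (bregman_ge0 dgf).
    have {}l1 := ler_wpM2l (ltW g0) l1; have {}l3 := mulr_ge0 (ltW g0) l3.
    have l4 := ler_wpM2r (sqr_ge0 (N (v - v'))) gd.
    rewrite -mulrA in l4.
    move: l1 l2 l3 l4; rewrite /H !(dotvBl, dotvDl, dotvZl).
    set a := N _ ^+ 2; lra.
  - by apply: measurable_coordsD => //; exact: measurable_coordsZ.
  move=> t x Zx; have := (eg t).2 x Zx.
  have := bE t _ _ Zx (Zu t); rewrite /H.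
  rewrite !(dotvBl, dotvDl, dotvZl); lra.
have mHu := measurable_oracle_gap d0 lip mH mu_ Zu mxi.
have [b mb bE] := measurable_gradient_representative dgf.1 cZ mu_ Zu.
have Zzn t : Z (zn t) := (upd t).1.
apply: (@measurable_vi_solution _ _ Z _ hN _ _
  (fun v => (1 + alpha) *: gw v) (fun=> 0) 1
  (fun t => (1 + alpha) *: b t - gamma *: (H (z t) (xi t) - H (u t) (xi t)))) => //.
- move=> v v' Zv Zv'; rewrite mul1r.
  have l2 := gradient_strongly_monotone hN dgf Zv Zv'.
  rewrite -scalerBr dotvZl mulrDl mul1r (le_trans l2) // lerDl.
  by rewrite mulr_ge0 // (le_trans _ l2) // sqr_ge0.
- apply: measurable_coordsB; apply: measurable_coordsZ => //.
  exact: measurable_coordsB.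
move=> t x Zx; have := paus_update_vi dgf cZ (upd t) Zx.
have := bE t _ _ Zx (Zzn t); rewrite /H.
rewrite !(dotvBl, dotvDl, dotvZl) => ->; lra.
Qed.

End paus_step_measurability.

(** * Independence and the past of an i.i.d. sequence *)
Section independence.
Set Implicit Arguments.
Unset Strict Implicit.
Local Open Scope ereal_scope.
Context {R : realType} {dO dX : measure_display}.
Context {O : measurableType dO} {X : measurableType dX}.
Context {P : probability O R} {D : probability X R}.

(** Independence says that the joint law of [Y] and [xi] is a product measure;
    Fubini's theorem then integrates [f] first. *)
Lemma independent_centered_product (Y : O -> R) (xi : O -> X) (f : X -> R) :
  measurable_fun setT xi ->
  (forall A, measurable A -> P (xi @^-1` A) = D A) ->
  (forall A B, measurable A -> measurable B ->
     P (Y @^-1` A `&` xi @^-1` B) = P (Y @^-1` A) * P (xi @^-1` B)) ->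
  P.-integrable setT (EFin \o Y) -> D.-integrable setT (EFin \o f) ->
  \int[D]_x (f x)%:E = 0 ->
  P.-integrable setT (fun o => (Y o * f (xi o))%:E) /\
  \int[P]_o (Y o * f (xi o))%:E = 0.
Proof.
move=> mxi law indep iY idf f0.
have mY : measurable_fun setT Y by apply/measurable_EFinP; exact: measurable_int iY.
have mf : measurable_fun setT f by apply/measurable_EFinP; exact: measurable_int idf.
have mphi : measurable_fun setT (fun o => (Y o, xi o)).
  exact: measurable_fun_pair.
pose Yp : {mfun O >-> R} :=
  MeasurableFun.Pack (MeasurableFun.Class (isMeasurableFun.Build _ _ _ _ _ mY)).
pose phi : {mfun O >-> (R * X)%type} :=
  MeasurableFun.Pack (MeasurableFun.Class (isMeasurableFun.Build _ _ _ _ _ mphi)).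
pose PY := distribution P Yp.
pose J := distribution P phi.
pose h (p : R * X) : \bar R := (p.1 * f p.2)%:E.
have prodE A : measurable A -> (PY \x D) A = J A.
  apply: product_measure_unique => {}A B mA mB.
  rewrite /J /distribution /pushforward /= -(law _ mB) -indep //.
have mh : measurable_fun setT h.
  apply/measurable_EFinP; apply: measurable_funM; first exact: measurable_fst.
  by apply: measurableT_comp => //; exact: measurable_snd.
have absY : \int[PY]_a `|a%:E| < +oo.
  rewrite (ge0_integral_pushforward mY) //; last first.
    apply: measurableT_comp => //; apply/measurable_EFinP; exact: measurable_id.
  by have /integrableP[_] := iY.
have absf : \int[D]_x `|(f x)%:E| < +oo by have /integrableP[_] := idf.
have absh a x : `|h (a, x)| = `|a%:E| * `|(f x)%:E| by rewrite /h /= normrM EFinM.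
have inth : (PY \x D).-integrable setT h.
  apply/(integrable12ltyP _ _ mh).
  under eq_integral => a _.
    under eq_integral do rewrite absh.
    rewrite ge0_integralZl //; last first.
      by apply: measurableT_comp => //; apply/measurable_EFinP.
    over.
  rewrite ge0_integralZr //; last 2 first.
    by apply: measurableT_comp => //.
    by apply: integral_ge0.
  apply: lte_mul_pinfty => //; first exact: integral_ge0.
  by rewrite ge0_fin_numE //; exact: integral_ge0.
have inthJ : P.-integrable setT (h \o phi).
  have /integrableP[_] := inth.
  rewrite (@eq_measure_integral _ _ _ _ J); last by move=> A mA _; exact: prodE.
  rewrite (ge0_integral_pushforward mphi) //; last by apply: measurableT_comp.
  move=> lty; apply/integrableP; split=> //.
  by apply: measurableT_comp => //.
split; first exact: inthJ.
transitivity (\int[J]_p h p).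
  by rewrite (integral_pushforward mphi) // preimage_setT.
rewrite (@eq_measure_integral _ _ _ _ (PY \x D)); last first.
  by move=> A mA _; apply/esym; exact: prodE.
rewrite -integral12_prod_meas1 // /fubini_F.
under eq_integral => a _.
  under eq_integral do rewrite /h /= EFinM.
  rewrite integralZl // f0 mule0.
  over.
by rewrite integral0.
Qed.

(** The cylinders over the samples before time [k]: a generator, stable under
    intersection, of the sigma-algebra of events known at time [k]. *)
Definition past (xi : nat -> O -> X) (k : nat) : set (set O) :=
  [set C | exists2 A : nat -> set X, forall i, measurable (A i) &
     C = \bigcap_(i in `I_k) (xi i @^-1` A i)].

Lemma pastS (xi : nat -> O -> X) k : past xi k `<=` past xi k.+1.
Proof.
move=> _ [A mA ->].
exists (fun i => if (i < k)%N then A i else setT) => [i|]; first by case: ifP.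
apply/seteqP; split=> o Ao i /= ik.
  by case: ifP => // {}ik; exact: Ao.
have ik1 : (i < k.+1)%N by rewrite ltnS ltnW.
by have := Ao i ik1; rewrite /= ik.
Qed.

Lemma past_sample (xi : nat -> O -> X) k i (B : set X) :
  (i < k)%N -> measurable B -> past xi k (xi i @^-1` B).
Proof.
move=> ik mB; exists (fun j => if j == i then B else setT).
  by move=> j; case: ifP.
apply/seteqP; split=> o /=.
  by move=> Bo j jk /=; case: eqP => // ->.
by move=> /(_ i ik) /=; rewrite eqxx.
Qed.

Lemma past_setI_closed (xi : nat -> O -> X) k : setI_closed (past xi k).
Proof.
move=> _ _ [A mA ->] [B mB ->]; exists (fun i => A i `&` B i).
  by move=> i; exact: measurableI.
by rewrite -bigcapI; apply: eq_bigcapr.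
Qed.

Section iid.
Context {K : nat} {xi : nat -> O -> X}.
Hypothesis iid : iid_samples P D K xi.

Lemma past_measurable k : (k <= K)%N -> past xi k `<=` measurable.
Proof.
move=> kK _ [A mA ->]; apply: bigcap_measurableType => i /= ik.
have [mxi _ _] := iid.
rewrite -[X in measurable X]setTI; apply: mxi => //.
exact: leq_trans ik kK.
Qed.

Lemma past_sigma_algebra_measurable k : (k <= K)%N ->
  <<s past xi k >> `<=` @measurable _ O.
Proof.
move=> kK; apply: smallest_sub; first exact: sigma_algebra_measurable.
exact: past_measurable.
Qed.

Lemma iid_prefix k (A : nat -> set X) : (k <= K)%N ->
  (forall i, measurable (A i)) ->
  P (\bigcap_(i in `I_k) (xi i @^-1` A i)) = \prod_(i < k) P (xi i @^-1` A i).
Proof.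
move=> kK mA; have [_ _ indep] := iid.
pose A' i := if (i < k)%N then A i else setT.
have -> : \bigcap_(i in `I_k) (xi i @^-1` A i)
    = \bigcap_(i in `I_K) (xi i @^-1` A' i).
  apply/seteqP; split=> o Ao i /= ik.
    by rewrite /A'; case: ifP => // {}ik; exact: Ao.
  by have := Ao i (leq_trans ik kK); rewrite /A' /= ik.
rewrite indep; last by move=> i; rewrite /A'; case: ifP.
rewrite (big_ord_widen _ (fun i => P (xi i @^-1` A i)) kK) [RHS]big_mkcond.
apply: eq_bigr => i _; rewrite /A'; case: ifP => // _.
by rewrite preimage_setT probability_setT.
Qed.

(** On cylinders this is the product rule of the sequence, used for [k] and for
    [k.+1] samples. Both sides are finite measures in [E], so that their equality
    extends to the generated sigma-algebra. *)
Lemma past_independent k (E : set O) (B : set X) : (k < K)%N ->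
  <<s past xi k >> E -> measurable B ->
  P (E `&` xi k @^-1` B) = P E * P (xi k @^-1` B).
Proof.
move=> kK sE mB; have [mxi _ _] := iid.
have mxB : measurable (xi k @^-1` B).
  by rewrite -[X in measurable X]setTI; exact: mxi.
have pc : (0 <= fine (P (xi k @^-1` B)))%R by rewrite fine_ge0.
pose m1 := mrestr P mxB.
pose m2 := mscale (NngNum pc) P.
have m2E S : m2 S = P S * P (xi k @^-1` B).
  by rewrite /m2 /mscale /= fineK ?fin_num_measure // muleC.
rewrite -m2E -[LHS]/(m1 E).
apply: (@g_sigma_algebra_measure_unique _ _ _ (past xi k) _ (fun=> setT)) => //.
- exact: past_measurable (ltnW kK).
- move=> _; exists (fun=> setT) => //.
  by apply/seteqP; split.
- by rewrite bigcup_const //; exists 0%N.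
- exact: past_setI_closed.
- move=> C [A mA CE]; transitivity (P C * P (xi k @^-1` B)); last by rewrite -m2E.
  rewrite /= /m1 /mrestr CE.
  pose A' i := if (i < k)%N then A i else B.
  have -> : \bigcap_(i in `I_k) (xi i @^-1` A i) `&` xi k @^-1` B
      = \bigcap_(i in `I_k.+1) (xi i @^-1` A' i).
    apply/seteqP; split=> [t [Ao Bo] i|t Ao].
      rewrite /= ltnS leq_eqVlt /A' => /orP[/eqP->|ik]; first by rewrite ltnn.
      by rewrite ik; exact: Ao.
    split=> [i /= ik|].
      by have := Ao i (ltnW ik); rewrite /A' /= ik.
    by have := Ao k (ltnSn k); rewrite /A' /= ltnn.
  rewrite iid_prefix //; last by move=> i; rewrite /A'; case: ifP.
  rewrite big_ord_recr /= /A' ltnn; congr (_ * _).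
  rewrite iid_prefix //; last exact: ltnW.
  by apply: eq_bigr => i _; rewrite ltn_ord.
- move=> _; rewrite /= /m1 /mrestr setTI.
  exact: le_lt_trans (probability_le1 _ mxB) (ltry _).
Qed.

End iid.

End independence.

(** * Adapted iterates and expectations *)
Section expected_contraction.
Set Implicit Arguments.
Unset Strict Implicit.
Context {R : realType} {dO : measure_display} {O : measurableType dO}.
Context {P : probability O R}.

(** If [a] has infinite mean, the right-hand side is infinite since its factor is
    positive. Otherwise all terms are integrable, the noise [l] disappears, and
    dividing by [1 + t] gives the factor [1 - t / 2], because
    [(1 + t) * (1 - t / 2) >= 1] for [t] between 0 and 1. The term [l] is required
    to be integrable only in that second case, which is when the distance to the
    solution is known to be integrable. *)
Lemma expected_contraction (a b n l : O -> R) (t c gamma s : R) :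
  0 <= t -> t <= 1 -> 0 <= c -> 0 <= s ->
  measurable_fun setT a -> measurable_fun setT b -> measurable_fun setT n ->
  (forall o, 0 <= a o) -> (forall o, 0 <= b o) -> (forall o, 0 <= n o) ->
  (forall o, (1 + t) * b o <= a o + c * n o - gamma * l o) ->
  (\int[P]_o (n o)%:E <= s%:E)%E ->
  (P.-integrable setT (EFin \o a) ->
     P.-integrable setT (EFin \o l) /\ (\int[P]_o (l o)%:E = 0)%E) ->
  (\int[P]_o (b o)%:E <= (1 - t / 2)%:E * \int[P]_o (a o)%:E + (c * s)%:E)%E.
Proof.
move=> t0 t1 c0 s0 ma mb mn a0 b0 n0 step ns al.
have Ea0 : (0 <= \int[P]_o (a o)%:E)%E by apply: integral_ge0 => o _; rewrite lee_fin.
have [Eoo|Elt] := eqVneq (\int[P]_o (a o)%:E)%E +oo%E.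
  by rewrite Eoo gt0_muley ?lte_fin ?addye ?leey //; lra.
have ia : P.-integrable setT (EFin \o a).
  apply/integrableP; split; first exact/measurable_EFinP.
  under eq_integral => o _ do rewrite /= ger0_norm //.
  by rewrite ltey.
have in_ : P.-integrable setT (EFin \o n).
  apply/integrableP; split; first exact/measurable_EFinP.
  under eq_integral => o _ do rewrite /= ger0_norm //.
  exact: le_lt_trans ns (ltry _).
have [il l0] := al ia.
have intE : (\int[P]_o (a o + c * n o - gamma * l o)%:E =
    \int[P]_o (a o)%:E + c%:E * \int[P]_o (n o)%:E)%E.
  under eq_integral do rewrite EFinB EFinD !EFinM.
  rewrite integralB //=; last 2 first.
    by apply: integrableD => //; exact: integrableZl.
    exact: integrableZl.
  rewrite integralD //=; last exact: integrableZl.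
  by rewrite !integralZl // l0 mule0 sube0.
have ml : measurable_fun setT l by apply/measurable_EFinP; exact: measurable_int il.
have : ((1 + t)%:E * \int[P]_o (b o)%:E <=
    \int[P]_o (a o)%:E + c%:E * \int[P]_o (n o)%:E)%E.
  rewrite -intE -ge0_integralZl //; last 3 first.
    exact/measurable_EFinP.
    by move=> o _; rewrite lee_fin.
    by rewrite lee_fin addr_ge0.
  apply: ge0_le_integral => //.
  - by move=> o _; rewrite -EFinM lee_fin mulr_ge0 // addr_ge0.
  - by apply/measurable_EFinP; apply: measurable_funM => //; exact: measurable_cst.
  - apply/measurable_EFinP; apply: measurable_funB.
      by apply: measurable_funD => //; apply: measurable_funM => //; exact: measurable_cst.
    by apply: measurable_funM => //; exact: measurable_cst.
  - by move=> o _; rewrite -EFinM lee_fin.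
have fa := integrable_fin_num measurableT ia.
have fn := integrable_fin_num measurableT in_.
move: Ea0 ns; rewrite -(fineK fa) -(fineK fn).
set A := fine _; set S := fine _; rewrite !lee_fin => A0 Ss.
have Eb0 : (0 <= \int[P]_o (b o)%:E)%E by apply: integral_ge0 => o _; rewrite lee_fin.
case EB : (\int[P]_o (b o)%:E)%E Eb0 => [B| |] //.
  rewrite -!EFinM -!EFinD !lee_fin => B0 H.
  have cS : c * S <= c * s by rewrite ler_wpM2l.
  have cs : 0 <= c * s by rewrite mulr_ge0.
  have t1' : 0 < 1 + t by lra.
  rewrite -(ler_pM2l t1') (le_trans H) //.
  have : 0 <= (t - t ^+ 2) / 2 * A.
    rewrite mulr_ge0 // divr_ge0 // expr2 subr_ge0.
    by rewrite -[leRHS]mulr1 ler_wpM2l.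
  have := mulr_ge0 t0 cs; lra.
by move=> _; rewrite gt0_muley ?lte_fin //; lra.
Qed.

End expected_contraction.

Section paus_iterates.
Set Implicit Arguments.
Unset Strict Implicit.
Context {R : realType} {d : nat} {Z : set 'rV[R]_d} {N : 'rV[R]_d -> R}.
Context {w : 'rV[R]_d -> R} {gw : 'rV[R]_d -> 'rV[R]_d}.
Hypotheses (hN : is_norm N) (dgf : distance_generating N Z w gw).
Hypothesis cZ : convex_set Z.
Context {dO dX : measure_display} {O : measurableType dO} {X : measurableType dX}.

(** By induction: [z k.+1] is obtained from [z k] and the sample [xi k] by two inner
    problems whose solutions depend measurably on them. *)
Lemma paus_iterate_adapted (g : 'rV[R]_d -> R) (F1 : 'rV[R]_d -> 'rV[R]_d)
    (G : 'rV[R]_d -> X -> 'rV[R]_d) (gamma mu delta : R) (K : nat)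
    (z0 : 'rV[R]_d) (z u : nat -> O -> 'rV[R]_d) (xi : nat -> O -> X) :
  0 < delta ->
  (forall x, lipschitz_dual_on N Z delta (fun v => F1 v - G v x)) ->
  (forall v, Z v -> measurable_coords (G v)) ->
  0 <= mu -> (forall x, strongly_monotone_on Z w gw mu (G ^~ x)) ->
  0 < gamma -> gamma <= (2 * delta)^-1 -> Z z0 ->
  (forall o, paus_run Z g w gw F1 G gamma (gamma * mu / 2) K z0
               (xi ^~ o) (z ^~ o) (u ^~ o)) ->
  forall k, (k <= K)%N ->
    @measurable_coords R _ (g_sigma_algebraType (past xi k)) d (z k) /\
    forall o, Z (z k o).
Proof.
move=> d0 lip mG mu0 smon g0 gle Zz0 run; elim=> [_|k IH kK].
  have z00 : z 0%N = fun=> z0 by apply/funext => o; exact: (run o).1.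
  by rewrite z00; split=> // j; exact: measurable_cst.
have [mz Zz] := IH (ltnW kK).
have upd o := ((run o).2 k kK).2.
split=> [|o]; last exact: (upd o).1.
pose T := g_sigma_algebraType (past xi k.+1).
have mzT : @measurable_coords R _ T d (z k).
  move=> j _ Y mY; have := mz j measurableT Y mY.
  exact: sub_sigma_algebra2 (@pastS _ _ _ _ xi k) _.
have mxi : @measurable_fun _ _ T X setT (xi k).
  move=> _ Y mY; rewrite setTI; apply: sub_sigma_algebra.
  exact: past_sample.
exact: (@measurable_paus_step _ _ _ _ _ _ hN dgf cZ _ _ T X g F1 G gamma mu delta
  (z k) (u k) (z k.+1) (xi k) d0 lip mG mu0 smon g0 gle mzT Zz mxi
  (fun o => ((run o).2 k kK).1) upd).
Qed.

End paus_iterates.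

Section noise.
Set Implicit Arguments.
Unset Strict Implicit.
Context {R : realType} {d : nat} {Z : set 'rV[R]_d} {N : 'rV[R]_d -> R}.
Context {w : 'rV[R]_d -> R} {gw : 'rV[R]_d -> 'rV[R]_d}.
Hypotheses (hN : is_norm N) (dgf : distance_generating N Z w gw).
Context {dO dX : measure_display} {O : measurableType dO} {X : measurableType dX}.
Context {P : probability O R} {D : probability X R}.
Context {K : nat} {xi : nat -> O -> X}.
Hypothesis iid : iid_samples P D K xi.

Lemma adapted_measurable (z : O -> 'rV[R]_d) k : (k <= K)%N ->
  @measurable_coords R _ (g_sigma_algebraType (past xi k)) d z ->
  measurable_coords z.
Proof.
move=> kK mz j _ Y mY; have := mz j measurableT Y mY; rewrite setTI.
exact: (past_sigma_algebra_measurable iid kK).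
Qed.

Lemma law_expectation (n : X -> R) k : (k < K)%N ->
  measurable_fun setT n -> (forall x, 0 <= n x) ->
  (\int[P]_o (n (xi k o))%:E = \int[D]_x (n x)%:E)%E.
Proof.
move=> kK mn n0; have [mxi law _] := iid.
have mn' : measurable_fun setT (EFin \o n) by apply/measurable_EFinP.
transitivity (\int[pushforward P (xi k)]_x (n x)%:E)%E.
  rewrite (ge0_integral_pushforward (mxi k kK)) // ?preimage_setT //.
  by move=> x _; rewrite lee_fin.
apply: eq_measure_integral; first exact: (mxi k kK).
by move=> mf A mA _; exact: (law k kK).
Qed.

(** The divergence dominates half of the square of the norm, hence the norm up to an
    additive constant. *)
Lemma coord_integrable (zs : 'rV[R]_d) (z : O -> 'rV[R]_d) j :
  Z zs -> measurable_coords z -> (forall o, Z (z o)) ->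
  P.-integrable setT (fun o => (bregman w gw zs (z o))%:E) ->
  P.-integrable setT (fun o => (z o ord0 j - zs ord0 j)%:E).
Proof.
move=> Zzs mz Zz iV.
have [c c0 Nc] := is_norm_lower hN.
have bnd o : `|z o ord0 j - zs ord0 j| <= c^-1 * (2^-1 + bregman w gw zs (z o)).
  rewrite mulrC ler_pdivlMr // mulrC.
  have := bregman_ge dgf Zzs (Zz o).
  rewrite -(is_normN hN) opprB => H.
  have l1 : c * `|z o ord0 j - zs ord0 j| <= N (z o - zs).
    apply: le_trans (Nc _); rewrite ler_pM2l //.
    by have := coord_le_norm (z o - zs) j; rewrite !mxE.
  have := sqr_ge0 (N (z o - zs) - 1); lra.
apply: (@le_integrable _ _ _ P _ _ _
  (fun o => c^-1%:E * ((2^-1)%:E + (bregman w gw zs (z o))%:E))%E) => //.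
- by apply/measurable_EFinP; apply: measurable_funB => //; exact: measurable_cst.
- move=> o _; rewrite -EFinD -EFinM !abse_EFin lee_fin.
  by apply: (le_trans (bnd o)); exact: ler_norm.
apply: integrableZl => //; apply: integrableD => //.
exact: finite_measure_integrable_cst.
Qed.

(** Coordinate by coordinate, the iterate is known before the sample is drawn, and
    the noise has mean zero under the law of the sample. *)
Lemma noise_centered (h : X -> 'rV[R]_d) (zs : 'rV[R]_d)
    (z : O -> 'rV[R]_d) k : (k < K)%N ->
  has_mean D h 0 -> Z zs ->
  @measurable_coords R _ (g_sigma_algebraType (past xi k)) d z ->
  (forall o, Z (z o)) ->
  P.-integrable setT (fun o => (bregman w gw zs (z o))%:E) ->
  P.-integrable setT (fun o => (dotv (h (xi k o)) (z o - zs))%:E) /\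
  (\int[P]_o (dotv (h (xi k o)) (z o - zs))%:E = 0)%E.
Proof.
move=> kK mean Zzs mz Zz iV; have [mxi law _] := iid.
have mzO := adapted_measurable (ltnW kK) mz.
have -> : (fun o => (dotv (h (xi k o)) (z o - zs))%:E) = (fun o =>
    (\sum_(j < d) ((z o ord0 j - zs ord0 j) * h (xi k o) ord0 j)%:E)%E).
  apply/funext => o; rewrite sumEFin; congr EFin; apply: eq_bigr => j _.
  by rewrite !mxE mulrC.
have H j : P.-integrable setT
      (fun o => ((z o ord0 j - zs ord0 j) * h (xi k o) ord0 j)%:E) /\
    (\int[P]_o ((z o ord0 j - zs ord0 j) * h (xi k o) ord0 j)%:E = 0)%E.
  have [ih h0] := mean j.
  apply: (@independent_centered_product _ _ _ _ _ P D
    (fun o => z o ord0 j - zs ord0 j) (xi k) (fun x => h x ord0 j)) => //.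
  - exact: (mxi k kK).
  - exact: (law k kK).
  - move=> A B mA mB; apply: (past_independent iid kK) => //.
    have m : @measurable_fun _ _ (g_sigma_algebraType (past xi k)) R setT
        (fun o => z o ord0 j - zs ord0 j).
      by apply: measurable_funB; [exact: mz|exact: measurable_cst].
    by have := m measurableT A mA; rewrite setTI.
  - exact: coord_integrable.
  - by move: h0; rewrite unlock mxE.
split; first by apply: integrable_sum => [|j _]; [exact: measurableT|exact: (H j).1].
rewrite integral_sum //; last by move=> j; exact: (H j).1.
by rewrite big1 // => j _; exact: (H j).2.
Qed.

End noise.

Theorem theorem4p2 (R : realType) (d m : nat)
    (Z : set 'rV[R]_d) (N : 'rV[R]_d -> R)
    (w : 'rV[R]_d -> R) (gw : 'rV[R]_d -> 'rV[R]_d)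
    (g : 'rV[R]_d -> R) (Fi : 'I_m.+1 -> 'rV[R]_d -> 'rV[R]_d)
    (dX : measure_display) (X : measurableType dX) (D : probability X R)
    (Xi : 'I_m.+1 -> Type) (comp : forall i, X -> Xi i)
    (Gi : forall i, 'rV[R]_d -> Xi i -> 'rV[R]_d)
    (L delta sigma mu gamma : R) (zs z0 : 'rV[R]_d)
    (dO : measure_display) (Omega : measurableType dO) (P : probability Omega R)
    (K : nat) (xi : nat -> Omega -> X) (z u : nat -> Omega -> 'rV[R]_d) :
  let F := avg_op Fi in
  let F1 := Fi ord0 in
  let G := avg_oracle comp Gi in
  let V := bregman w gw in
  closed Z -> convex_set Z -> is_norm N ->
  distance_generating N Z w gw ->
  convex_function Z g -> lsc_on Z g ->
  monotone_on Z F -> lipschitz_dual_on N Z L F ->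
  vi_solution Z F g zs ->
  0 < delta ->
  (forall x, lipschitz_dual_on N Z delta (fun v => F1 v - G v x)) ->
  (forall v, Z v -> has_mean D (G v) (F v)) ->
  ('E_D[(fun x => (dual_norm N (G zs x - F zs) ^+ 2)%R)] <= (sigma ^+ 2)%:E)%E ->
  0 <= mu ->
  (forall x, strongly_monotone_on Z w gw mu (G ^~ x)) ->
  0 < gamma -> gamma <= (2 * delta)^-1 -> gamma * mu <= 2 ->
  Z z0 ->
  iid_samples P D K xi ->
  (forall o, paus_run Z g w gw F1 G gamma (gamma * mu / 2) K z0
               (xi ^~ o) (z ^~ o) (u ^~ o)) ->
  forall k, (k < K)%N ->
    ('E_P[(fun o => V zs (z k.+1 o))] <=
      (1 - gamma * mu / 4)%:E * 'E_P[(fun o => V zs (z k o))]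
      + (2 * gamma ^+ 2 / 3 * sigma ^+ 2)%:E)%E.
Proof.
move=> F F1 G V _ cZ hN dgf _ _ _ _ sol d0 lip mean var mu0 smon g0 gle gm Zz0 iid run.
move=> k kK.
have Zzs := sol.1.
have [mxi law _] := iid.
have mG v : Z v -> measurable_coords (G v).
  move=> Zv j; apply/measurable_EFinP; exact: measurable_int ((mean v Zv j).1).
have adapted := paus_iterate_adapted hN dgf cZ d0 lip mG mu0 smon g0 gle Zz0 run.
have [mzk Zzk] := adapted k (ltnW kK).
have [mzk1 Zzk1] := adapted k.+1 kK.
have mzO := adapted_measurable iid (ltnW kK) mzk.
have mz1O := adapted_measurable iid kK mzk1.
pose q x := G zs x - F zs.
have mq : measurable_coords q.
  by apply: measurable_coordsB; [exact: mG|move=> j; exact: measurable_cst].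
pose n x := dual_norm N (q x) ^+ 2.
have mn : measurable_fun setT n.
  apply: measurable_funX; apply: (measurable_fun_factor mq) => x e e0.
  have [C C0 HC] := dual_norm_lipschitz hN.
  exists (e / C) => [|x']; first by rewrite divr_gt0.
  by rewrite ltr_pdivlMr // mulrC; apply: le_lt_trans.
have n0 x : 0 <= n x by exact: sqr_ge0.
have mean0 : has_mean D q 0.
  move=> j; have [ij ej] := mean _ Zzs j.
  have iF : D.-integrable setT (fun=> (F zs ord0 j)%:E).
    exact: finite_measure_integrable_cst.
  have qE x : (q x ord0 j)%:E = ((G zs x ord0 j)%:E - (F zs ord0 j)%:E)%E.
    by rewrite /q !mxE.
  split; first by under eq_fun do rewrite qE; exact: integrableB.
  rewrite unlock; under eq_integral do rewrite qE.
  rewrite integralB // integral_cst //= probability_setT mule1.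
  by move: ej; rewrite unlock => ->; rewrite subee // mxE.
rewrite !unlock.
have -> : 1 - gamma * mu / 4 = 1 - gamma * mu / 2 / 2 by field.
apply: (@expected_contraction _ _ _ P _ _ (fun o => n (xi k o))
  (fun o => dotv (q (xi k o)) (z k o - zs)) _ _ gamma).
- by rewrite divr_ge0 // mulr_ge0 // ltW.
- lra.
- by rewrite divr_ge0 // mulr_ge0 // sqr_ge0.
- exact: sqr_ge0.
- exact: (measurable_bregman dgf.1 cZ mzO Zzk Zzs).
- exact: (measurable_bregman dgf.1 cZ mz1O Zzk1 Zzs).
- by apply: measurableT_comp => //; exact: mxi.
- by move=> o; exact: (bregman_ge0 dgf Zzs (Zzk o)).
- by move=> o; exact: (bregman_ge0 dgf Zzs (Zzk1 o)).
- by move=> o; exact: n0.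
- move=> o; have [eg upd] := (run o).2 k kK.
  exact: (paus_descent hN dgf cZ sol d0 (lip _) mu0 (smon _) g0 gle (Zzk o) eg upd).
- by rewrite (law_expectation iid kK mn n0); move: var; rewrite unlock.
- move=> ia; exact: (noise_centered hN dgf iid kK mean0 Zzs mzk Zzk ia).
Qed.
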